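(* Let $n\ge2$ be an integer and $b=-n+i$. Let $D\subset\{0,1,\ldots,|b|^2-1\}$ satisfy $d\le n^2/2$ for all $d\in D$ and $|a-a'|\neq1$ for all $a,a'\in D-D$. Let $z=\sum_{k\ge1}z_kb^{-k}$ with $z_k\in D-D$ for every $k\ge1$. Then $$\underline{\dim}_B\bigl(C_D\cap(C_D+z)\bigr)=\liminf_{m\to\infty}\frac{\log G_m(z)}{m\log|b|},$$ where $$G_m(z):=|D\cap(D+z_1)|\,|D\cap(D+z_2)|\cdots|D\cap(D+z_m)|.$$
   Context: Here $|b|^2=n^2+1$; $D$ is nonempty; $D-D=\{d-d':d,d'\in D\}$; $D+t=\{d+t:d\in D\}$; $|S|$ denotes the cardinality of a finite set $S$; and $C_D=\{\sum_{k\ge1}d_kb^{-k}\in\mathbb C:d_k\in D\}$. $G_m(z)$ is computed from the given digit sequence $(z_k)$. The lower box-counting dimension is $\underline{\dim}_BV=\liminf_{\delta\to0^+}\frac{\log N_\delta(V)}{-\log\delta}$, where $N_\delta(V)$ is the minimum number of sets of diameter at most $\delta$ needed to cover $V$. *)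

(* Defs.v *)
From HB Require Import structures.
From mathcomp Require Import all_boot all_order all_algebra finmap complex.
From mathcomp Require Import all_classical all_reals all_analysis.

Set Implicit Arguments.
Unset Strict Implicit.
Unset Printing Implicit Defensive.

Import Order.TTheory GRing.Theory Num.Theory numFieldNormedType.Exports.

Local Open Scope classical_set_scope.
Local Open Scope ring_scope.
Local Open Scope complex_scope.

(** * Box-counting dimension in the complex plane *)

(* [normc] is the complex modulus as an element of [R], whereas [`|x|] is an
   element of [R[i]].  The diameter of the empty set is [-oo]. *)
Definition diameter (R : realType) (U : set R[i]) : \bar R :=
  ereal_sup [set (Normc.normc (p.1 - p.2))%:E | p in U `*` U].

Definition covered_by (R : realType) (delta : R) (V : set R[i]) (N : nat) :=
  exists U : 'I_N -> set R[i],
    (forall j, (diameter (U j) <= delta%:E)%E) /\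
    V `<=` \bigcup_(j in [set: 'I_N]) U j.

(* The infimum is a minimum when some finite cover exists and [+oo] when none
   does. *)
Definition covering_number (R : realType) (delta : R) (V : set R[i]) :
    \bar R :=
  ereal_inf [set (N%:R)%:E | N in covered_by delta V].

(* [lne 0 = -oo], so that the empty set has dimension [-oo]. *)
Definition lower_box_dim (R : realType) (V : set R[i]) : \bar R :=
  limf_einf (fun delta : R =>
    (lne (covering_number delta V) / (- ln delta)%:E)%E) 0^'+.

(** * Radix expansions *)

Definition base (R : realType) (n : nat) : R[i] := (- n%:R) +i* 1.

(* [d k] is the digit of [b ^ (-k)] for [k >= 1]; [d 0] is not used.  The
   topology on the complex numbers is carried by the regular module [R[i]^o]. *)
Definition expansion (R : realType) (b : R[i]) (d : nat -> int) (x : R[i]) :=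
  (fun m : nat => (\sum_(1 <= k < m.+1) (d k)%:~R * b ^- k : R[i]^o))
    @ \oo --> (x : R[i]^o).

Definition restricted_digit_set (R : realType) (b : R[i]) (D : {fset int}) :
    set R[i] :=
  [set x | exists2 d : nat -> int,
     (forall k, (1 <= k)%N -> d k \in D) & expansion b d x].

Definition difference_set (D : {fset int}) : {fset int} :=
  [fset (d - d')%R | d in D, d' in D]%fset.

Definition shift_fset (D : {fset int}) (t : int) : {fset int} :=
  [fset (d + t)%R | d in D]%fset.

Definition shift_set (R : realType) (C : set R[i]) (t : R[i]) : set R[i] :=
  [set x + t | x in C].

Definition digit_count (D : {fset int}) (z : nat -> int) (m : nat) : nat :=
  (\prod_(1 <= k < m.+1) #|` (D `&` shift_fset D (z k))%fset|)%N.

(* Main.v *)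
Require Import Defs.
From HB Require Import structures.
From mathcomp Require Import all_boot all_order all_algebra finmap complex.
From mathcomp Require Import all_classical all_reals all_analysis.
From mathcomp Require Import zify ring lra.

(** Write [b = -n + i], [beta = |b|], so that [beta ^ 2 = n ^ 2 + 1], and let
    [E_k = D \cap (D + z_k)].

    First, the intersection is again given by digits.  If [x] and [y = x - z]
    lie in [C_D], the digits of [x] minus those of [y] form an expansion of [z]
    with digits in [D - D], just as [(z_k)] does.  Such expansions are unique
    ([difference_expansion_unique]), hence [C_D \cap (C_D + z)] is the set [K]
    of all [\sum_k d_k b^-k] with [d_k] in [E_k] ([intersection_digits]).

    Uniqueness reduces to showing that [\sum_k c_k b^-k = 0] with
    [|c_k| <= n^2] and [|c_k| <> 1] forces [c = 0].  The Gaussian integers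
    [s_m = \sum_(k <= m) c_k b^(m-k)] satisfy [s_(m+1) = b s_m + c_(m+1)] and,
    being minus the rescaled tail of the series, stay in the disc of radius
    [n^2 / (beta - 1) = beta + 1].  Feeding this bound back into the recursion
    improves the bound on the imaginary parts to 2, and even to 1 for
    [n >= 3].  But if [c_j] is the first nonzero digit, then [s_j = c_j] and
    [s_(j+1)] has imaginary part [c_j], of absolute value at least 2.  This is
    a contradiction for [n >= 3]; for [n = 2] one more step of the recursion
    gives an imaginary part of absolute value at least 4
    ([bounded_orbit_eq0]).

    Second, let [P_m] be the set of the Gaussian integers
    [\sum_(k <= m) d_k b^(m-k)] with [d_k] in [E_k].  Digits lie in
    [0, ..., n^2], a complete residue system modulo [b], so different words
    give different integers and [|P_m| = G_m].  The sets [K] and [b^-m P_m] are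
    at Hausdorff distance at most [(beta + 1) beta^-m].  Therefore [G_m] discs
    of that radius cover [K]; conversely, a set of diameter at most [beta^-m]
    is close to a bounded number of points of [b^-m P_m], as these are
    [beta^-m]-separated.  So the covering number at scale [beta^-m] is [G_m] up
    to constant factors ([covering_number_le], [covering_number_ge]), which do
    not affect the lower limits ([liminf_logN_eq]). *)

Set Implicit Arguments.
Unset Strict Implicit.
Unset Printing Implicit Defensive.

Import Order.TTheory GRing.Theory Num.Theory numFieldNormedType.Exports.

Local Open Scope classical_set_scope.
Local Open Scope ring_scope.
Local Open Scope complex_scope.

Local Notation normc := Normc.normc.

(** * The modulus on the complex numbers *)

Section Modulus.
Context {R : realType}.
Implicit Types x y : R[i].

Lemma normc_ge0 x : 0 <= normc x.
Proof. by case: x => a c; exact: sqrtr_ge0. Qed.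

Lemma normc_triangle x y : normc (x + y) <= normc x + normc y.
Proof. exact: le_normcD. Qed.

Lemma normc_distC x y : normc (x - y) = normc (y - x).
Proof. by rewrite -opprB; exact: normcN. Qed.

Lemma normc_dist_triangle y x z :
  normc (x - z) <= normc (x - y) + normc (y - z).
Proof. by rewrite -[x - z](subrKA y) normc_triangle. Qed.

Lemma normcX x k : normc (x ^+ k) = normc x ^+ k.
Proof. by elim: k => [|k IH]; rewrite ?Normc.normc1// !exprS Normc.normcM IH. Qed.

Lemma normc_int (c : int) : normc (c%:~R : R[i]) = `|c%:~R|.
Proof.
have -> : (c%:~R : R[i]) = (c%:~R)%:C by rewrite rmorph_int.
by rewrite /= expr0n addr0 sqrtr_sqr.
Qed.

Lemma normc_ge_Re x : `|complex.Re x| <= normc x.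
Proof. by case: x => a c /=; rewrite -sqrtr_sqr ler_wsqrtr// lerDl sqr_ge0. Qed.

Lemma normc_ge_Im x : `|complex.Im x| <= normc x.
Proof. by case: x => a c /=; rewrite -sqrtr_sqr ler_wsqrtr// lerDr sqr_ge0. Qed.

Lemma normc_le_ReIm x : normc x <= `|complex.Re x| + `|complex.Im x|.
Proof.
case: x => a c /=; rewrite -[leRHS]ger0_norm ?addr_ge0// -sqrtr_sqr ler_wsqrtr//.
by rewrite sqrrD !real_normK ?num_real// addrAC lerDl mulrn_wge0 ?mulr_ge0.
Qed.

End Modulus.

(** * Radix expansions in a base of modulus greater than 1 *)

Lemma scaled_expn_small {R : realType} (beta C e : R) : 1 < beta -> 0 < e ->
  \forall m \near \oo, C * beta ^- m < e.
Proof.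
move=> b1 e0; have b0 : 0 < beta by exact: lt_trans b1.
have : geometric C beta^-1 @ \oo --> 0.
  by apply: cvg_geometric; rewrite ger0_norm ?invr_ge0 ?(ltW b0)// invf_lt1.
move=> /cvgrPdist_lt/(_ e e0); apply: filterS => m.
by rewrite sub0r normrN /= exprVn; apply: le_lt_trans; rewrite ler_norm.
Qed.

Section Expansions.
Context {R : realType}.
Variable b : R[i].
Hypothesis b_gt1 : 1 < normc b.
Local Notation beta := (normc b).
Implicit Types (d e : nat -> int) (x y : R[i]) (C : R).

Definition partial_sum d m : R[i] := \sum_(1 <= k < m.+1) (d k)%:~R * b ^- k.

Lemma partial_sumS d m :
  partial_sum d m.+1 = partial_sum d m + (d m.+1)%:~R * b ^- m.+1.
Proof. by rewrite /partial_sum big_nat_recr. Qed.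

Lemma partial_sumB d e m :
  partial_sum (fun k => d k - e k) m = partial_sum d m - partial_sum e m.
Proof.
by rewrite /partial_sum -sumrB; apply: eq_bigr => k _; rewrite rmorphB mulrBl.
Qed.

(** Limits in [R[i]^o] are tested against positive elements of [R[i]], which are
    exactly the positive reals; this brings the convergence back to [R]. *)
Lemma expansionP d x : expansion b d x <->
  forall e : R, 0 < e -> \forall m \near \oo, normc (x - partial_sum d m) < e.
Proof.
split=> [/cvgrPdist_lt dx e e0|dx].
  have /dx : (0 : R[i]) < e%:C by rewrite ltcR.
  by apply: filterS => m; rewrite ltcR.
apply/cvgrPdist_lt => -[e e']; rewrite ltcE /= => /andP[/eqP-> e0].
by apply: filterS (dx _ e0) => m; rewrite -ltcR.
Qed.

Lemma expansionB d e x y : expansion b d x -> expansion b e y ->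
  expansion b (fun k => d k - e k) (x - y).
Proof.
move=> dx ey; apply: cvg_trans (cvgB dx ey).
by under [X in X @ _ --> _]eq_fun do rewrite -/(partial_sum _ _) partial_sumB.
Qed.

Lemma beta_gt0 : 0 < beta. Proof. exact: lt_trans b_gt1. Qed.

(** The sharp geometric bound: keeping the subtracted term makes the induction
    on [p] an identity. *)
Lemma partial_sum_dist C d m p :
    (forall k, (1 <= k)%N -> `|(d k)%:~R| <= C) ->
  normc (partial_sum d m - partial_sum d (m + p)) <=
  C / (beta - 1) * (beta ^- m - beta ^- (m + p)).
Proof.
move=> dC; have b0 := beta_gt0; elim: p => [|p IH].
  by rewrite addn0 !subrr mulr0 Normc.normc0.
rewrite addnS; apply: le_trans (normc_dist_triangle (partial_sum d (m + p)) _ _) _.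
have -> : C / (beta - 1) * (beta ^- m - beta ^- (m + p).+1) =
  C / (beta - 1) * (beta ^- m - beta ^- (m + p)) + C * beta ^- (m + p).+1.
  have b1 : beta - 1 != 0 by rewrite subr_eq0 gt_eqF.
  rewrite [in RHS]exprS [in LHS]exprS; field.
  by rewrite b1 !expf_neq0 gt_eqF.
apply: lerD => //; rewrite normc_distC partial_sumS addrC addKr.
rewrite Normc.normcM normc_int Normc.normcV normcX ler_wpM2r ?dC//.
by rewrite invr_ge0 exprn_ge0 // ltW.
Qed.

Lemma expansion_tail C d x m :
    (forall k, (1 <= k)%N -> `|(d k)%:~R| <= C) -> expansion b d x ->
  normc (x - partial_sum d m) <= C / (beta - 1) * beta ^- m.
Proof.
move=> dC /expansionP dx; apply/ler_addgt0Pr => e /dx [N _ dxN].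
have C0 : 0 <= C := le_trans (normr_ge0 _) (dC 1%N isT).
apply: le_trans (normc_dist_triangle (partial_sum d (m + N)) _ _) _.
rewrite addrC; apply: lerD; last by apply/ltW/dxN; rewrite /= leq_addl.
rewrite normc_distC; apply: le_trans (partial_sum_dist m _ dC) _.
rewrite ler_wpM2l ?divr_ge0// ?subr_ge0 ?(ltW b_gt1)// gerBl invr_ge0 exprn_ge0//.
exact: ltW beta_gt0.
Qed.

(** Every bounded digit sequence is realised: the real and imaginary parts of
    the partial sums are Cauchy sequences in [R]. *)
Lemma expansion_exists C d : (forall k, (1 <= k)%N -> `|(d k)%:~R| <= C) ->
  exists x, expansion b d x.
Proof.
move=> dC.
have C0 : 0 <= C := le_trans (normr_ge0 _) (dC 1%N isT).
have part (f : R[i] -> R) : (forall x y, f (x - y) = f x - f y) ->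
    (forall x, `|f x| <= normc x) ->
    exists l, (fun m => f (partial_sum d m)) @ \oo --> (l : R).
  move=> fB fle; apply/cvg_ex; apply: cauchy_cvg; apply: cauchy_exP => e e0.
  have [N _ /(_ N (leqnn N)) Ne] := scaled_expn_small (C / (beta - 1)) b_gt1 e0.
  exists (f (partial_sum d N)); exists N => // m /= /subnKC <-.
  rewrite /ball/= -fB; apply: le_lt_trans (fle _) (le_lt_trans _ Ne).
  apply: le_trans (partial_sum_dist N _ dC) _.
  rewrite ler_wpM2l ?divr_ge0// ?subr_ge0 ?(ltW b_gt1)// gerBl invr_ge0 exprn_ge0//.
  exact: ltW beta_gt0.
have [u ul] := part (@complex.Re R) (fun x y => raddfB _ x y) normc_ge_Re.
have [v vl] := part (@complex.Im R) (fun x y => raddfB _ x y) normc_ge_Im.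
exists (u +i* v); apply/expansionP => e e0; have e20 : 0 < e / 2 by rewrite divr_gt0.
move/cvgrPdist_lt: ul => /(_ _ e20) ul; move/cvgrPdist_lt: vl => /(_ _ e20) vl.
near=> m; apply: le_lt_trans (normc_le_ReIm _) _.
rewrite !raddfB /= [e]splitr ltrD//.
  by near: m; exact: ul.
by near: m; exact: vl.
Unshelve. all: by end_near. Qed.

End Expansions.

(** * Integer orbits of the digit recursion *)

Section GaussianPrefixes.
Implicit Types (n m k : nat) (d c : nat -> int) (p q : int * int).

(** The map [s |-> b s + a] on Gaussian integers, written in the coordinates
    [(Re s, Im s)] for [b = -n + i]. *)
Definition append_digit n p (a : int) : int * int :=
  (- (n%:Z * p.1) - p.2 + a, p.1 - n%:Z * p.2).

Fixpoint prefix n d m : int * int :=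
  if m is k.+1 then append_digit n (prefix n d k) (d m) else (0, 0).

(** The difference of two digits giving the same value is divisible by [b],
    hence, being an integer, by [n^2 + 1]. *)
Lemma append_digit_inj n p q (a a' : int) : `|a - a'| <= n%:Z ^+ 2 ->
  append_digit n p a = append_digit n q a' -> p = q /\ a = a'.
Proof.
case: p q => [x y] [x' y']; rewrite /append_digit /= => aa' [e1 e2].
have ex : x - x' = n%:Z * (y - y') by rewrite mulrBr; lia.
have ea : a - a' = (n%:Z ^+ 2 + 1) * (y - y').
  by rewrite expr2 mulrDl mul1r -mulrA -ex; nia.
have ey : y - y' = 0.
  by move: aa'; rewrite ea; nia.
by move: ex ea; rewrite ey !mulr0 => ex ea; split; [congr pair|]; lia.
Qed.

(** If [(x', y')] follows [(x, y)] with digit [a], then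
    [(n^2 + 1) y = a - x' - n y']: the imaginary part contracts backwards in
    time, so a bound valid for the whole orbit improves itself. *)
Lemma bounded_orbit_Im_le2 n d m :
    (2 <= n)%N -> (forall k, (1 <= k)%N -> `|d k| <= n%:Z ^+ 2) ->
    (forall k, `|(prefix n d k).1| <= n%:Z + 1 /\ `|(prefix n d k).2| <= n%:Z + 1) ->
  `|(prefix n d m).2| <= 2.
Proof.
move=> n2 /(_ m.+1 isT) dn /(_ m.+1); rewrite /=.
case: (prefix n d m) => x y /= []; move: (d m.+1) dn => a; nia.
Qed.

(** The same contraction, started from the bound 2 on [y']. *)
Lemma bounded_orbit_Im_le1 n d m :
    (3 <= n)%N -> (forall k, (1 <= k)%N -> `|d k| <= n%:Z ^+ 2) ->
    (forall k, `|(prefix n d k).1| <= n%:Z + 1 /\ `|(prefix n d k).2| <= n%:Z + 1) ->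
  `|(prefix n d m).2| <= 1.
Proof.
move=> n3 dn bnd; have := bounded_orbit_Im_le2 m.+1 (ltnW n3) dn bnd.
move: dn bnd => /(_ m.+1 isT) dn /(_ m.+1); rewrite /=.
case: (prefix n d m) => x y /= []; move: (d m.+1) dn => a; nia.
Qed.

(** The first nonzero digit [d_k] reappears as the imaginary part of the next
    orbit point, which then breaks the bounds above since [|d_k| >= 2]. *)
Lemma bounded_orbit_eq0 n d :
    (2 <= n)%N -> (forall k, (1 <= k)%N -> `|d k| <= n%:Z ^+ 2) ->
    (forall k, (1 <= k)%N -> `|d k| != 1) ->
    (forall k, `|(prefix n d k).1| <= n%:Z + 1 /\ `|(prefix n d k).2| <= n%:Z + 1) ->
  forall k, (1 <= k)%N -> d k = 0.
Proof.
move=> n2 dn d1 bnd.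
suff pre0 k : prefix n d k = (0, 0) /\ forall j, (1 <= j <= k)%N -> d j = 0.
  by move=> k k1; apply: (pre0 k).2; rewrite k1 leqnn.
elim: k => [|k [IH dj]]; first by split=> // -[].
have dk : d k.+1 = 0.
  have pk1 : prefix n d k.+1 = (d k.+1, 0).
    by rewrite /= IH /append_digit /=; congr pair; lia.
  have := d1 k.+1 isT; have := dn k.+1 isT.
  have := dn k.+2 isT.
  have pk2 : prefix n d k.+2 = (- (n%:Z * d k.+1) + d k.+2, d k.+1).
    rewrite [LHS]/= -/(prefix n d k.+1) pk1 /append_digit /=; congr pair; lia.
  have [n3|] := leqP 3 n.
    by have := bounded_orbit_Im_le1 k.+2 n3 dn bnd; rewrite pk2 /=; lia.
  (* For n = 2 the second next imaginary part is d_(k+2) - 4 d_(k+1), where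
     |d_(k+2)| <= 4 and |d_(k+1)| = 2. *)
  move=> n3; have {n3} ne2 : n = 2 by lia.
  have := bounded_orbit_Im_le2 k.+3 n2 dn bnd.
  rewrite [prefix _ _ _]/= -/(prefix n d k.+2) pk2 /append_digit /= ne2; lia.
split; first by rewrite /= IH dk /append_digit /= !(mulr0, oppr0, addr0).
move=> j /andP[j1]; rewrite leq_eqVlt => /predU1P[->//|jk].
by apply: dj; rewrite j1.
Qed.

End GaussianPrefixes.

(** * Expansions in base [-n + i] *)

Section BaseExpansions.
Context {R : realType}.
Variable n : nat.
Hypothesis n_ge2 : (2 <= n)%N.
Local Notation b := (base R n).
Local Notation beta := (normc b).

Definition gauss (p : int * int) : R[i] := (p.1%:~R) +i* (p.2%:~R).

Lemma sqr_normc_base : beta ^+ 2 = n%:R ^+ 2 + 1.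
Proof. by rewrite /= sqr_sqrtr ?addr_ge0 ?sqr_ge0// sqrrN expr1n. Qed.

Lemma base_gt1 : 1 < beta.
Proof.
have n1 : 1 <= n%:R :> R by rewrite ler1n ltnW.
have := sqr_normc_base; have := normc_ge0 b; move: beta => x; nra.
Qed.

(** The radius of the disc that contains all tails with digits at most [n^2],
    by [beta ^ 2 - 1 = n ^ 2]. *)
Lemma base_tail_constant : n%:R ^+ 2 / (beta - 1) = beta + 1.
Proof.
have b1 : beta - 1 != 0 by rewrite subr_eq0 gt_eqF// base_gt1.
apply: (mulIf b1); rewrite divfK//; have := sqr_normc_base; move: beta => x; nra.
Qed.

Lemma gauss_append_digit p a : gauss (append_digit n p a) = b * gauss p + a%:~R.
Proof.
have -> : (a%:~R : R[i]) = a%:~R +i* 0 by rewrite -[LHS](rmorph_int (real_complex R)).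
rewrite /gauss /append_digit /base; simpc => /=.
by congr (_ +i* _); rewrite ?(rmorphD, rmorphB, rmorphN, rmorphM) /=; ring.
Qed.

Lemma base_neq0 : b != 0.
Proof.
by apply/eqP => b0; have := base_gt1; rewrite b0 Normc.normc0 ltr10.
Qed.

(** Truncated expansions are rescaled Gaussian integers. *)
Lemma partial_sum_prefix d m : partial_sum b d m = gauss (prefix n d m) * b ^- m.
Proof.
have b0 := base_neq0.
elim: m => [|m IH].
  rewrite /partial_sum big_geq// /gauss /= expr0 invr1 mulr1.
  by apply/eqP; rewrite eq_complex /= !eqxx.
rewrite partial_sumS IH [prefix _ _ _]/= gauss_append_digit mulrDl exprS.
by congr (_ + _); field; rewrite b0 expf_neq0.
Qed.

Lemma dist_prefix d m (x : R[i]) :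
    (forall k, (1 <= k)%N -> `|d k| <= n%:Z ^+ 2) -> expansion b d x ->
  normc (x - gauss (prefix n d m) * b ^- m) <= (beta + 1) * beta ^- m.
Proof.
move=> dn dx; rewrite -partial_sum_prefix -base_tail_constant.
apply: expansion_tail => //; first exact: base_gt1.
move=> k /dn; rewrite -(ler_int R) intr_norm rmorphXn /=.
by rewrite -pmulrn.
Qed.

(** The orbit of an expansion of 0 lies in the disc of radius [beta + 1 < n + 2];
    its coordinates are integers, hence at most [n + 1]. *)
Lemma expansion0_eq0 d :
    (forall k, (1 <= k)%N -> `|d k| <= n%:Z ^+ 2) ->
    (forall k, (1 <= k)%N -> `|d k| != 1) ->
  expansion b d 0 -> forall k, (1 <= k)%N -> d k = 0.
Proof.
move=> dn d1 d0; apply: (bounded_orbit_eq0 n_ge2 dn d1) => m.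
have bm : 0 < beta ^+ m by rewrite exprn_gt0// (lt_trans _ base_gt1).
have := dist_prefix m dn d0; rewrite sub0r.
rewrite [normc (- _)]normcN Normc.normcM Normc.normcV normcX.
rewrite ler_pM2r ?invr_gt0// => pm.
have bn : beta < n%:R + 1.
  have n1 : 1 <= n%:R :> R by rewrite ler1n ltnW.
  have := sqr_normc_base; have := base_gt1; move: beta => x; nra.
have small (a : int) : `|a%:~R| <= normc (gauss (prefix n d m)) -> `|a| <= n%:Z + 1.
  move=> am; rewrite -ltzD1 -(ltr_int R) intr_norm.
  apply: le_lt_trans am (le_lt_trans pm _).
  by rewrite !rmorphD /= -pmulrn ltrD2r.
by split; apply: small; [exact: normc_ge_Re (gauss _)|exact: normc_ge_Im (gauss _)].
Qed.

End BaseExpansions.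

(** * Lists of admissible prefixes *)

Section PrefixLists.
Variable n : nat.
Implicit Types (E : nat -> {fset int}) (d : nat -> int) (m k : nat) (p q : int * int).

Fixpoint prefixes E m : seq (int * int) :=
  if m is k.+1 then [seq append_digit n p a | p <- prefixes E k, a <- enum_fset (E m)]
  else [:: (0, 0)].

Lemma size_prefixes E m :
  size (prefixes E m) = (\prod_(1 <= k < m.+1) #|` E k|)%N.
Proof.
elim: m => [|m IH]; first by rewrite big_geq.
by rewrite big_nat_recr//= size_allpairs IH.
Qed.

Lemma uniq_prefixes E m :
    (forall k a a', (1 <= k)%N -> a \in E k -> a' \in E k -> `|a - a'| <= n%:Z ^+ 2) ->
  uniq (prefixes E m).
Proof.
move=> En; elim: m => [//|m IH] /=; apply: allpairs_uniq => //; first exact: fset_uniq.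
move=> _ _ /allpairsP[[p a] /= [_ aE ->]] /allpairsP[[q a'] /= [_ a'E ->]] /=.
by case/(append_digit_inj (En m.+1 _ _ isT aE a'E)) => -> ->.
Qed.

Lemma prefix_in_prefixes E d m : (forall k, (1 <= k)%N -> d k \in E k) ->
  prefix n d m \in prefixes E m.
Proof.
by move=> dE; elim: m => [|m IH]; rewrite ?mem_head//=; apply: allpairs_f => //; exact: dE.
Qed.

Lemma eq_prefix d d' m : (forall k, (k <= m)%N -> d k = d' k) -> prefix n d m = prefix n d' m.
Proof.
elim: m => //= m IH dd'; rewrite dd'// IH// => k km.
by rewrite dd'// ltnW.
Qed.

Lemma prefixes_extend E m p : (forall k, (1 <= k)%N -> E k != fset0) ->
  p \in prefixes E m ->
  exists2 d, forall k, (1 <= k)%N -> d k \in E k & prefix n d m = p.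
Proof.
move=> E0; elim: m p => [|m IH] p /=.
  rewrite inE => /eqP->.
  have /choice[d dE] k : exists a, (1 <= k)%N -> a \in E k.
    case: k => [|k]; first by exists 0.
    by have /fset0Pn[a aE] := E0 k.+1 isT; exists a.
  by exists d.
case/allpairsP => -[q a] /= [/IH[d dE dq] aE ->].
exists (fun k => if k == m.+1 then a else d k).
  by move=> k k1; case: eqP => [->//|_]; exact: dE.
rewrite eqxx -dq; congr append_digit; apply: eq_prefix => k km.
by rewrite ltn_eqF.
Qed.

End PrefixLists.

(** * Covering numbers of digit-product sets *)

Section Coverings.
Context {R : realType}.
Variable n : nat.
Hypothesis n_ge2 : (2 <= n)%N.
Local Notation b := (base R n).
Local Notation beta := (normc b).
Variable E : nat -> {fset int}.
Hypothesis E_neq0 : forall k, (1 <= k)%N -> E k != fset0.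
Hypothesis E_bounded : forall k a, (1 <= k)%N -> a \in E k -> 0 <= a <= n%:Z ^+ 2.

Definition digit_product_set : set R[i] :=
  [set x | exists2 d, forall k, (1 <= k)%N -> d k \in E k & expansion b d x].

Local Notation P m := (prefixes n E m).
Local Notation grid p m := (gauss p * b ^- m : R[i]).
Local Notation K := digit_product_set.

Lemma E_norm k a : (1 <= k)%N -> a \in E k -> `|a| <= n%:Z ^+ 2.
Proof. by move=> k1 /(E_bounded k1)/andP[a0]; rewrite ger0_norm. Qed.

Lemma set_near_prefixes m (x : R[i]) : K x ->
  exists2 p, p \in P m & normc (x - grid p m) <= (beta + 1) * beta ^- m.
Proof.
move=> [d dE dx]; exists (prefix n d m); first exact: prefix_in_prefixes.
by apply: dist_prefix dx => // k k1; apply: E_norm (dE k k1).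
Qed.

Lemma prefixes_near_set m p : p \in P m ->
  exists2 x : R[i], K x & normc (x - grid p m) <= (beta + 1) * beta ^- m.
Proof.
move=> /(prefixes_extend E_neq0)[d dE dp].
have dn k : (1 <= k)%N -> `|d k| <= n%:Z ^+ 2 by move=> k1; apply: E_norm (dE k k1).
have [x dx] : exists x, expansion b d x.
  apply: (expansion_exists (base_gt1 n_ge2) (C := (n%:Z ^+ 2)%:~R)) => k /dn dkn.
  by rewrite -intr_norm ler_int; exact: dkn.
by exists x; [exists d|rewrite -dp; exact: dist_prefix].
Qed.

Lemma diameter_ball (c : R[i]) (r : R) :
  (diameter [set x | normc (x - c) <= r]%R <= (r + r)%:E)%E.
Proof.
apply: ge_ereal_sup => _ [[x y] [/= xr yr] <-]; rewrite lee_fin.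
apply: le_trans (normc_dist_triangle c _ _) _.
by rewrite lerD// normc_distC.
Qed.

Lemma covering_number_le m (delta : R) :
    ((beta + 1) *+ 2) * beta ^- m <= delta ->
  (covering_number delta K <= (size (P m))%:R%:E)%E.
Proof.
move=> md; apply: ereal_inf_lbound; exists (size (P m)) => //.
exists (fun j : 'I_(size (P m)) =>
  [set x | normc (x - grid (nth (0, 0) (P m) j) m) <= (beta + 1) * beta ^- m]); split.
  move=> j; apply: le_trans (diameter_ball _ _) _.
  by rewrite lee_fin -mulr2n -mulrnAl.
move=> x /(set_near_prefixes m)[p pP xp].
have ip : (index p (P m) < size (P m))%N by rewrite index_mem.
by exists (Ordinal ip) => //=; rewrite nth_index.
Qed.

Lemma gaussB p q : gauss p - gauss q = gauss (p.1 - q.1, p.2 - q.2) :> R[i].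
Proof. by rewrite /gauss; simpc; rewrite /= !rmorphB. Qed.

(** Reduction modulo [L] separates the Gaussian integers of a set of diameter
    less than [L]; it lets the pigeonhole argument below avoid choosing a centre
    for each set of the cover. *)
Lemma gauss_close_congr (L : nat) p q : normc (gauss p - gauss q : R[i]) < L%:R ->
  (p.1 = q.1 %[mod L])%Z -> (p.2 = q.2 %[mod L])%Z -> p = q.
Proof.
rewrite gaussB => pqL.
have congr0 (s t : int) : `|(s - t)%:~R| < L%:R :> R -> (s = t %[mod L])%Z -> s = t.
  rewrite -intr_norm pmulrn ltr_int => stL /eqP; rewrite eqz_mod_dvd => /dvdzP[k stk].
  move: stL; rewrite stk => kL; have k0 : k = 0 by nia.
  by move: stk; rewrite k0 mul0r; lia.
case: p q pqL => [x y] [x' y'] pqL xx' yy'; congr pair; apply: congr0 => //.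
  exact: le_lt_trans (normc_ge_Re (gauss (x - x', y - y'))) pqL.
exact: le_lt_trans (normc_ge_Im (gauss (x - x', y - y'))) pqL.
Qed.

(** Send a prefix [p] to a set of the cover that contains a point of [K] near
    [b^-m p], together with the residues of [p] modulo [2 n + 5].  Two
    prefixes with the same set differ by at most [1 + 2 (beta + 1)], which is
    less than [2 n + 5], so this map is injective. *)
Lemma size_prefixes_le_cover m (delta : R) N : delta <= beta ^- m ->
  Defs.covered_by delta K N -> (size (P m) <= N * (2 * n + 5) ^ 2)%N.
Proof.
move=> dm [U [Ud UK]].
have /choice[f fU] (i : 'I_(size (P m))) : exists j : 'I_N, exists2 x,
    U j x & normc (x - grid (nth (0, 0) (P m) i) m) <= (beta + 1) * beta ^- m.
  have [x Kx xp] := prefixes_near_set (mem_nth (0, 0) (ltn_ord i)).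
  by have [j _ Ujx] := UK x Kx; exists j, x.
(* Written as a successor so that inord applies. *)
pose L := (2 * n + 4).+1.
pose res (a : int) : 'I_L := inord `|(a %% L)%Z|%N.
have res_congr a a' : res a = res a' -> (a = a' %[mod L])%Z.
  have resK s : res s = `|(s %% L)%Z|%N :> nat.
    by rewrite inordK//; have := @ltz_pmod s L isT; have := @modz_ge0 s L isT; lia.
  move/(congr1 val); rewrite /= !resK.
  by have := @modz_ge0 a L isT; have := @modz_ge0 a' L isT; lia.
pose g (i : 'I_(size (P m))) :=
  (f i, res (nth (0, 0) (P m) i).1, res (nth (0, 0) (P m) i).2).
have /leq_card : injective g.
  move=> i i' [fii' /res_congr e1 /res_congr e2].
  suff /eqP : nth (0, 0) (P m) i = nth (0, 0) (P m) i'.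
    rewrite nth_uniq//; first by move/eqP/val_inj.
    apply: uniq_prefixes => k a a' k1 /(E_bounded k1) aE /(E_bounded k1) a'E; lia.
  apply: (gauss_close_congr _ e1 e2).
  have [x Ux xi] := fU i; have [y Uy yi] := fU i'; rewrite -fii' in Uy.
  have xy : normc (x - y) <= delta.
    rewrite -lee_fin; apply: le_trans (Ud (f i)).
    by apply: ereal_sup_ubound; exists (x, y).
  have b0 : 0 < beta ^+ m by rewrite exprn_gt0// (lt_trans _ (base_gt1 n_ge2)).
  have : normc (grid (nth (0, 0) (P m) i) m - grid (nth (0, 0) (P m) i') m) <=
      (beta *+ 2 + 3) * beta ^- m.
    apply: le_trans (normc_dist_triangle x _ _) _.
    have -> : (beta *+ 2 + 3) * beta ^- m =
      (beta + 1) * beta ^- m + (beta ^- m + (beta + 1) * beta ^- m) by ring.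
    rewrite normc_distC lerD//.
    apply: le_trans (normc_dist_triangle y _ _) _.
    by rewrite lerD// (le_trans xy).
  rewrite -mulrBl Normc.normcM Normc.normcV normcX ler_pM2r ?invr_gt0// => /le_lt_trans.
  apply.
  have n1 : 1 <= n%:R :> R by rewrite ler1n ltnW.
  have -> : L%:R = n%:R *+ 2 + 5 :> R by rewrite /L -addnS natrD natrM; ring.
  have := sqr_normc_base (R := R) n; have := base_gt1 n_ge2 (R := R); move: beta => t; nra.
rewrite !card_prod !card_ord /L; nia.
Qed.

Lemma covering_number_ge m (delta : R) : delta <= beta ^- m ->
  (((size (P m))%:R / ((2 * n + 5) ^ 2)%:R)%:E <= covering_number delta K)%E.
Proof.
move=> dm; apply: le_ereal_inf_tmp => _ [N cN <-]; rewrite lee_fin.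
rewrite ler_pdivrMr ?ltr0n; last by rewrite expn_gt0 addn_gt0 orbT.
by rewrite -natrM ler_nat (size_prefixes_le_cover dm).
Qed.

End Coverings.

(** * Comparison of lower limits *)

Section LowerLimits.
Context {R : realType}.

Lemma ge_limf_einf {T : choiceType} {X : filteredType T} (f : X -> \bar R)
    (F : set (set X)) (c : \bar R) :
  F [set x | (c <= f x)%E] -> (c <= limf_einf f F)%E.
Proof.
move=> Fc; rewrite limf_einfE.
apply: le_trans (ereal_sup_ubound (imageP _ Fc)).
by apply: le_ereal_inf_tmp => _ [x cx <-].
Qed.

(** The real slack between [c] and [c'] absorbs the error terms, so that no
    arithmetic with lower limits is needed. *)
Lemma limf_einf_le {T U : choiceType} {X : filteredType T} {Y : filteredType U}
    (f : X -> \bar R) (g : Y -> \bar R) (F : set_system X) (G : set_system Y) :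
    Filter F ->
    (forall c c' : R, c' < c -> (\forall x \near F, (c%:E <= f x)%E) ->
      \forall y \near G, (c'%:E <= g y)%E) ->
  (limf_einf f F <= limf_einf g G)%E.
Proof.
move=> FF fg.
have fgE (c c' : R) : c' < c -> (\forall x \near F, (c%:E <= f x)%E) ->
    (c'%:E <= limf_einf g G)%E by move=> cc' /(fg _ _ cc') /ge_limf_einf.
rewrite [leLHS]limf_einfE; apply: ge_ereal_sup => _ [V FV <-].
have fV (c : R) : (c%:E <= ereal_inf (f @` V))%E -> \forall x \near F, (c%:E <= f x)%E.
  move=> cV; apply: filterS FV => x Vx /=; apply: le_trans cV _.
  by apply: ereal_inf_lbound; exists x.
case: (ereal_inf (f @` V)) fV => [a||] fV; last by rewrite leNye.
  apply/lee_addgt0Pr => e e0; rewrite -leeBlDr// -EFinB.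
  by apply: (fgE a); [rewrite ltrBlDr ltrDl|exact: fV].
rewrite leye_eq; apply/eqP/eqyP => A A0.
by apply: (fgE (A + 1)); [rewrite ltrDl|apply: fV; rewrite leey].
Qed.

Lemma lne_le (x y : \bar R) : (x <= y)%E -> (lne x <= lne y)%E.
Proof.
case: x y => [x||] [y||] //=; rewrite ?leey ?leNye//.
rewrite lee_fin => xy; case: (leP x 0) => [_|x0]; first by rewrite leNye.
have y0 := lt_le_trans x0 xy.
by rewrite (lt_geF y0) lee_fin ler_ln ?posrE.
Qed.

End LowerLimits.

(** A covering function [N] that agrees with [G m] at scale [beta^-m], up to the
    constants [A] and [Q], grows logarithmically at the same rate. *)
Section ScalingDimension.
Context {R : realType}.
Variables (N : R -> \bar R) (G : nat -> nat) (beta A Q : R).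
Hypothesis beta_gt1 : 1 < beta.
Hypothesis A_gt0 : 0 < A.
Hypothesis Q_gt0 : 0 < Q.
Hypothesis G_gt0 : forall m, (0 < G m)%N.
Hypothesis N_le : forall m delta, A * beta ^- m <= delta -> (N delta <= (G m)%:R%:E)%E.
Hypothesis N_ge : forall m delta, delta <= beta ^- m -> (((G m)%:R / Q)%:E <= N delta)%E.

Let logG m : \bar R := (ln (G m)%:R / (m%:R * ln beta))%:E.
Let logN delta : \bar R := (lne (N delta) / (- ln delta)%:E)%E.

Let lnb : 0 < ln beta. Proof. exact: ln_gt0. Qed.
Let b0 : 0 < beta. Proof. exact: lt_trans beta_gt1. Qed.

Let ln_scale m : ln (beta ^- m) = - (m%:R * ln beta).
Proof. by rewrite lnV ?posrE ?exprn_gt0// lnXn// mulr_natl. Qed.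

Let near_linear_ge (a C : R) : 0 < a -> \forall m \near \oo, C <= a * m%:R.
Proof.
move=> a0; near=> m; rewrite mulrC -ler_pdivrMr//.
near: m; exact: nbhs_infty_ger.
Unshelve. all: by end_near. Qed.

Lemma ge_logN (c delta : R) : 0 < delta -> delta < 1 ->
  (c%:E <= logN delta)%E = ((c * - ln delta)%:E <= lne (N delta))%E.
Proof.
move=> d0 d1; have ld : 0 < - ln delta by rewrite oppr_gt0 ln_lt0// d0.
by rewrite /logN inver gt_eqF// lee_pdivlMr.
Qed.

Lemma ge_logG (c : R) m : (1 <= m)%N ->
  (c%:E <= logG m)%E = (c * (m%:R * ln beta) <= ln (G m)%:R).
Proof. by move=> m1; rewrite lee_fin ler_pdivlMr// mulr_gt0// ltr0n. Qed.

(** Sample [N] along the scales [A * beta^-m]; replacing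
    [m * ln beta - ln A] by [m * ln beta] costs a bounded amount, absorbed by
    [(c - c') * m * ln beta]. *)
Lemma liminf_logN_le : (limf_einf logN 0^'+ <= limn_einf logG)%E.
Proof.
apply: limf_einf_le => c c' cc' [r /= r0 cN].
near=> m.
have m1 : (1 <= m)%N by near: m; exact: nbhs_infty_ge.
rewrite ge_logG//.
have d0 : 0 < A * beta ^- m by rewrite mulr_gt0// invr_gt0 exprn_gt0.
have dr : A * beta ^- m < r by near: m; exact: scaled_expn_small.
have d1 : A * beta ^- m < 1 by near: m; exact: scaled_expn_small.
have : (c%:E <= logN (A * beta ^- m))%E by apply: cN => //=; rewrite sub0r normrN gtr0_norm.
rewrite ge_logN// => /le_trans/(_ (lne_le (N_le (lexx _)))).
rewrite lne_EFin ?ltr0n// lee_fin lnM ?posrE// ?invr_gt0 ?exprn_gt0// ln_scale.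
apply: le_trans.
have : c * ln A <= ((c - c') * ln beta) * m%:R.
  by near: m; apply: near_linear_ge; rewrite mulr_gt0// subr_gt0.
by move: (m%:R : R) (ln beta) (ln A) => *; lra.
Unshelve. all: by end_near. Qed.

(** Given [delta], take the [m] with [beta^-(m+1) < delta <= beta^-m].  Then
    [- ln delta] and [m * ln beta] differ by at most [ln beta]. *)
Lemma liminf_logN_ge : (limn_einf logG <= limf_einf logN 0^'+)%E.
Proof.
apply: limf_einf_le => c c' cc' [M _ cG].
(* For - ln delta > T, the chosen m exceeds M, and (c - c') * - ln delta exceeds
   the two errors |c| * ln beta, due to rounding the scale, and |ln Q|. *)
pose T := M.+1%:R * ln beta + (`|c| * ln beta + `|ln Q|) / (c - c').
have cc0 : 0 < c - c' by rewrite subr_gt0.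
have Q0 : 0 <= (`|c| * ln beta + `|ln Q|) / (c - c').
  by rewrite divr_ge0 ?(ltW cc0)// addr_ge0// mulr_ge0// ltW.
near=> delta.
have d0 : 0 < delta by near: delta; exact: nbhs_right_gt.
have dT : delta < expR (- T) by near: delta; apply: nbhs_right_lt; exact: expR_gt0.
set t := - ln delta.
have tT : T < t by rewrite /t ltrNr -[- T]expRK ltr_ln// posrE ?expR_gt0.
have Mt : M.+1%:R * ln beta < t by apply: le_lt_trans tT; rewrite lerDl.
have t0 : 0 < t by apply: le_lt_trans Mt; rewrite mulr_ge0// ltW.
have ct : `|c| * ln beta + `|ln Q| <= (c - c') * t.
  rewrite [leRHS]mulrC -ler_pdivrMr//; apply: le_trans (ltW tT).
  by rewrite lerDr mulr_ge0// ltW.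
have /truncn_itv/andP[] : 0 <= t / ln beta by rewrite divr_ge0 ?(ltW t0) ?(ltW lnb).
rewrite ler_pdivlMr// ltr_pdivrMr//; set m := Num.trunc _ => mt tm.
have Mm : (M.+1 <= m)%N.
  by rewrite -ltnS -(ltr_nat R) -(ltr_pM2r lnb) (lt_trans Mt).
have m1 : (1 <= m)%N by apply: leq_trans Mm.
have dm : delta <= beta ^- m.
  by rewrite -ler_ln ?posrE// ?invr_gt0 ?exprn_gt0// ln_scale lerNr.
have d1 : delta < 1.
  by rewrite -ltr_ln ?posrE// ln1 -oppr_gt0.
rewrite ge_logN//; apply: le_trans (lne_le (N_ge dm)).
rewrite lne_EFin ?divr_gt0 ?ltr0n// lee_fin lnM ?posrE ?invr_gt0 ?ltr0n// lnV ?posrE//.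
have : (c%:E <= logG m)%E by apply: cG => /=; exact: leq_trans Mm.
rewrite ge_logG// => cm.
rewrite -/t lerBrDr; apply: le_trans cm.
have qQ := ler_norm (ln Q).
suff : c * t - `|c| * ln beta <= c * (m%:R * ln beta) by move: ct; lra.
rewrite lerBlDl -lerBlDr -mulrBr; apply: le_trans (ler_norm _) _.
rewrite normrM ler_wpM2l// ger0_norm ?subr_ge0//.
by move: tm; rewrite -natr1 mulrDl mul1r => /ltW; rewrite lerBlDl.
Unshelve. all: by end_near. Qed.

Lemma liminf_logN_eq : limf_einf logN 0^'+ = limn_einf logG.
Proof. by apply/le_anti; rewrite liminf_logN_le liminf_logN_ge. Qed.

End ScalingDimension.

(** * The intersection as a digit-product set *)

Lemma difference_setP (D : {fset int}) (a : int) :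
  reflect (exists2 d, d \in D & exists2 d', d' \in D & a = d - d') (a \in difference_set D).
Proof.
apply: (iffP idP) => [/imfset2P[d dD [d' d'D ->]]|[d dD [d' d'D ->]]].
  by exists d => //; exists d'.
by apply/imfset2P; exists d => //; exists d'.
Qed.

Lemma mem_shift_fset (D : {fset int}) (t d : int) : (d \in shift_fset D t) = (d - t \in D).
Proof.
apply/imfsetP/idP => /= [[e eD ->]|dD]; first by rewrite addrK.
by exists (d - t); rewrite ?subrK.
Qed.

Section Intersection.
Context {R : realType}.
Variables (n : nat) (D : {fset int}) (zdigit : nat -> int) (z : R[i]).
Hypothesis n_ge2 : (2 <= n)%N.
Hypothesis D_bounds : forall d, d \in D -> 0 <= d /\ d *+ 2 <= n%:Z ^+ 2.
Hypothesis D_gap : forall a a', a \in difference_set D -> a' \in difference_set D ->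
  `|a - a'| != 1.
Hypothesis zdigit_diff : forall k, (1 <= k)%N -> zdigit k \in difference_set D.
Hypothesis z_expansion : expansion (base R n) zdigit z.

Definition fibre_digits k : {fset int} := (D `&` shift_fset D (zdigit k))%fset.

Lemma mem_fibre_digits k d :
  (d \in fibre_digits k) = (d \in D) && (d - zdigit k \in D).
Proof. by rewrite in_fsetI mem_shift_fset. Qed.

Lemma fibre_digits_neq0 k : (1 <= k)%N -> fibre_digits k != fset0.
Proof.
move=> /zdigit_diff/difference_setP[d dD [d' d'D zd]]; apply/fset0Pn; exists d.
by rewrite mem_fibre_digits dD zd opprB addrC subrK.
Qed.

Lemma difference_set_bound a : a \in difference_set D -> `|a| *+ 2 <= n%:Z ^+ 2.
Proof.
by case/difference_setP => d /D_bounds[? ?] [d' /D_bounds[? ?] ->]; lia.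
Qed.

(** Elements of [D - D] are at most [n^2 / 2] in absolute value, so differences
    of two of them are at most [n^2], and by [D_gap] never [1] or [-1]. *)
Lemma difference_expansion_unique a a' (x : R[i]) :
    (forall k, (1 <= k)%N -> a k \in difference_set D) ->
    (forall k, (1 <= k)%N -> a' k \in difference_set D) ->
    expansion (base R n) a x -> expansion (base R n) a' x ->
  forall k, (1 <= k)%N -> a k = a' k.
Proof.
move=> aD a'D ax a'x k k1; apply/eqP; rewrite -subr_eq0; apply/eqP.
have := expansionB ax a'x; rewrite subrr => /(expansion0_eq0 n_ge2); apply => // j j1.
  have := difference_set_bound (aD j j1); have := difference_set_bound (a'D j j1); lia.
exact: D_gap (aD j j1) (a'D j j1).
Qed.

Lemma intersection_digits :
  restricted_digit_set (base R n) D `&` shift_set (restricted_digit_set (base R n) D) z =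
  digit_product_set n fibre_digits.
Proof.
apply/seteqP; split => [x [[d dD dx] [y [e eD ey] yzx]]|x [d dE dx]].
  exists d => // k k1; rewrite mem_fibre_digits dD//=.
  have dez : expansion (base R n) (fun k => d k - e k) z.
    by have := expansionB dx ey; rewrite -yzx addrAC subrr add0r.
  rewrite -(difference_expansion_unique _ zdigit_diff dez z_expansion)//.
    by rewrite opprB addrC subrK eD.
  by move=> j j1; apply/difference_setP; exists (d j); rewrite ?dD//; exists (e j); rewrite ?eD.
split; first by exists d => // k /dE; rewrite mem_fibre_digits => /andP[].
exists (x - z); last by rewrite subrK.
exists (fun k => d k - zdigit k); last exact: expansionB.
by move=> k /dE; rewrite mem_fibre_digits => /andP[].
Qed.

End Intersection.

Theorem theorem0p3 (R : realType) (n : nat) (D : {fset int})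
    (zdigit : nat -> int) (z : R[i]) :
  (2 <= n)%N ->
  D != fset0 ->
  (forall d, d \in D -> 0 <= d /\ d%:~R <= Normc.normc (base R n) ^+ 2 - 1) ->
  (forall d, d \in D -> (d%:~R : R) <= n%:R ^+ 2 / 2) ->
  (forall a a', a \in difference_set D -> a' \in difference_set D ->
     `|a - a'| != 1) ->
  (forall k, (1 <= k)%N -> zdigit k \in difference_set D) ->
  expansion (base R n) zdigit z ->
  lower_box_dim (restricted_digit_set (base R n) D `&`
                 shift_set (restricted_digit_set (base R n) D) z) =
  limn_einf (fun m : nat =>
    (ln (digit_count D zdigit m)%:R / (m%:R * ln (Normc.normc (base R n))))%:E).
Proof.
move=> n2 _ D_ge0 D_half D_gap zD zz.
have D_bounds d : d \in D -> 0 <= d /\ d *+ 2 <= n%:Z ^+ 2.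
  move=> dD; split; first by case: (D_ge0 d dD).
  rewrite -(ler_int R) rmorphMn rmorphXn /= -pmulrn -mulr_natr.
  by rewrite -ler_pdivlMr// D_half.
rewrite (intersection_digits n2 D_bounds D_gap zD zz).
have E0 := fibre_digits_neq0 zD.
have E_bounds k a : (1 <= k)%N -> a \in fibre_digits D zdigit k -> 0 <= a <= n%:Z ^+ 2.
  by rewrite mem_fibre_digits => _ /andP[/D_bounds[a0 a2] _]; lia.
have countE m : digit_count D zdigit m = size (prefixes n (fibre_digits D zdigit) m).
  by rewrite size_prefixes.
apply: (liminf_logN_eq (base_gt1 n2) (A := (normc (base R n) + 1) *+ 2)
          (Q := ((2 * n + 5) ^ 2)%:R)).
- by rewrite pmulrn_rgt0// addr_gt0// (lt_trans _ (base_gt1 n2)).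
- by rewrite ltr0n expn_gt0 addn_gt0 orbT.
- move=> m; rewrite /digit_count big_nat_cond prodn_cond_gt0// => k /andP[/andP[k1 _] _].
  by rewrite cardfs_gt0; exact: E0.
- by move=> m delta md; rewrite countE; exact: covering_number_le.
- by move=> m delta md; rewrite countE; exact: covering_number_ge.
Qed.
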